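(* Up to isomorphism there are exactly $15$ right Bol loops of order $27$, of which exactly five are groups (so exactly ten are nonassociative).
   Context: A loop is a set with a binary multiplication and a two-sided identity $1$ in which all left and right translations are bijections. A loop is right Bol if it satisfies $((xy)z)y=x((yz)y)$ for all $x,y,z$. *)

(* Defs.v *)
From mathcomp Require Import all_boot.
Set Implicit Arguments. Unset Strict Implicit. Unset Printing Implicit Defensive.

Definition is_loop (T : Type) (m : T -> T -> T) : Prop :=
  (exists e : T, forall x, m e x = x /\ m x e = x) /\
  (forall a, bijective (m a)) /\
  (forall a, bijective (fun x => m x a)).

Definition right_bol (T : Type) (m : T -> T -> T) : Prop :=
  forall x y z, m (m (m x y) z) y = m x (m (m y z) y).

(* Isomorphism of magmas (for loops it automatically preserves identity). *)
Definition loop_iso (T1 T2 : Type) (m1 : T1 -> T1 -> T1) (m2 : T2 -> T2 -> T2)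
  : Prop :=
  exists f : T1 -> T2, bijective f /\ forall x y, f (m1 x y) = m2 (f x) (f y).

Definition is_group_loop (T : Type) (m : T -> T -> T) : Prop := associative m.

(* Main.v *)
From HB Require Import structures.
Require Import Defs.
From mathcomp Require Import all_boot all_fingroup all_solvable.
Set Implicit Arguments. Unset Strict Implicit. Unset Printing Implicit Defensive.

(** Let Q be a right Bol loop of order 27 with right translations R_x, so that
    R_y R_z R_y = R_{(yz)y}. On two copies of Q the involutions
    (0, x) -> (1, xk), (1, x) -> (0, xk^-1) form a single conjugacy class of 27
    elements in the group H that they generate, and the product of any two of
    them is a 3-element; hence one of them, s, normalises a Sylow 3-subgroup P
    of H, P is transitive on the class, and every product of s with a member of
    the class lies in P. Thus the group generated by the R_x is a 3-group. A
    maximal subgroup above the stabiliser of 1 yields a normal subloop N of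
    order 9, and a central element yields c in N of order 3 with
    c(xy) = (cx)y. Right Bol loops of order 9 are abelian groups; applied to
    isotopes of N this gives (xm)m' = x(mm') for m, m' in N.

    Write N = {u^i c^j} with u^3 = 1 or u^3 = c, and Q as the union of N, tN
    and t^-1 N. The loop is then determined by u^3, the permutations al, al' of
    N given by m t = t al(m) and m t^-1 = t^-1 al'(m), and n in N with
    tt = (n t^-1) n, because x((mt)m) = ((xm)t)m. Moreover al and al' are
    determined by their values at c, u and u^2. The Bol identity leaves
    177 + 87 such data, and each is matched with one of 15 representatives. *)

Declare Scope loop_scope.
Delimit Scope loop_scope with L.

(** * Arithmetic of coordinates *)

Inductive trit := Z0 | Z1 | Z2.

Definition nat_of_trit (i : trit) : nat := match i with Z0 => 0 | Z1 => 1 | Z2 => 2 end.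
Definition trit_of_nat (n : nat) : trit := match n with 0 => Z0 | 1 => Z1 | _ => Z2 end.

Lemma nat_of_trit_lt i : nat_of_trit i < 3.
Proof. by case: i. Qed.

Definition ord_of_trit (i : trit) : 'I_3 := Ordinal (nat_of_trit_lt i).
Definition trit_of_ord (i : 'I_3) : trit := trit_of_nat i.

Lemma ord_of_tritK : cancel ord_of_trit trit_of_ord.
Proof. by case. Qed.

Lemma trit_of_ordK : cancel trit_of_ord ord_of_trit.
Proof. by case=> -[|[|[|]]] // lti; apply: val_inj. Qed.

HB.instance Definition _ := Finite.copy trit (can_type ord_of_tritK).

Lemma card_trit : #|{: trit}| = 3.
Proof.
rewrite -[RHS]card_ord; apply: (@bij_eq_card _ _ ord_of_trit).
by exists trit_of_ord; [exact: ord_of_tritK | exact: trit_of_ordK].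
Qed.

Lemma inj_onto (A B : finType) (f : A -> B) :
  injective f -> #|A| = #|B| -> forall y, exists x, f x = y.
Proof.
move=> inj_f cardAB y.
have /codomP[x ->] : y \in codom f by rewrite inj_card_onto // cardAB.
by exists x.
Qed.

Definition eq3 (a b : trit) : bool :=
  match a, b with Z0, Z0 | Z1, Z1 | Z2, Z2 => true | _, _ => false end.
Definition add3 (a b : trit) : trit :=
  match a, b with
  | Z0, x | x, Z0 => x | Z1, Z1 => Z2 | Z2, Z2 => Z1 | _, _ => Z0
  end.
Definition opp3 (a : trit) : trit := match a with Z0 => Z0 | Z1 => Z2 | Z2 => Z1 end.
(* The exponent of c produced by u^i u^i' when u^3 = c^k. *)
Definition carry (k a b : trit) : trit :=
  match a, b with Z1, Z2 | Z2, Z1 | Z2, Z2 => k | _, _ => Z0 end.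

(* (i, j) : N9 stands for u^i c^j, and (l, a) : Q27 for t_l a with t_0 = 1, t_1
   = t, t_2 = t^-1. *)
Definition N9 : Type := trit * trit.
Definition Q27 : Type := trit * N9.
(* The boolean tests below use [if] where [&&] would read better because
   vm_compute is call by value and would evaluate both arguments of [&&]. *)
Definition eq9 (a b : N9) : bool := if eq3 a.1 b.1 then eq3 a.2 b.2 else false.
Definition eq27 (a b : Q27) : bool := if eq3 a.1 b.1 then eq9 a.2 b.2 else false.

Definition all3 (p : trit -> bool) :=
  if p Z0 then if p Z1 then p Z2 else false else false.
Definition all9 (p : N9 -> bool) := all3 (fun i => all3 (fun j => p (i, j))).
Definition all27 (p : Q27 -> bool) := all3 (fun l => all9 (fun x => p (l, x))).

Definition pick3 {A} (f : trit -> option A) : option A :=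
  if f Z0 is Some x then Some x else if f Z1 is Some x then Some x else f Z2.
Definition pick9 (p : N9 -> bool) : option N9 :=
  pick3 (fun i => pick3 (fun j => if p (i, j) then Some (i, j) else None)).
Definition pick27 (p : Q27 -> bool) : option Q27 :=
  pick3 (fun l => if pick9 (fun x => p (l, x)) is Some x then Some (l, x) else None).

Inductive tri (A : Type) := Tri of A & A & A.
Definition get3 {A} (t : tri A) (i : trit) : A :=
  let: Tri a b c := t in match i with Z0 => a | Z1 => b | Z2 => c end.
Definition tab3 {A} (f : trit -> A) : tri A := Tri (f Z0) (f Z1) (f Z2).
Definition memo9 {A} (f : N9 -> A) : N9 -> A :=
  let t := tab3 (fun i => tab3 (fun j => f (i, j))) in
  fun x => get3 (get3 t x.1) x.2.
Definition memo27 {A} (f : Q27 -> A) : Q27 -> A :=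
  let t := tab3 (fun l => tab3 (fun i => tab3 (fun j => f (l, (i, j))))) in
  fun x => get3 (get3 (get3 t x.1) x.2.1) x.2.2.

(** * The abelian group [N9] and the finite search for loop data *)

Definition o9 : N9 := (Z0, Z0).
Definition o27 : Q27 := (Z0, o9).
Definition add9 (k : trit) (x y : N9) : N9 :=
  (add3 x.1 y.1, add3 (add3 x.2 y.2) (carry k x.1 y.1)).
Definition opp9 (k : trit) (x : N9) : N9 :=
  let i := opp3 x.1 in (i, opp3 (add3 x.2 (carry k x.1 i))).
Definition inv9 (f : N9 -> N9) (y : N9) : N9 :=
  odflt o9 (pick9 (fun x => eq9 (f x) y)).
Definition onto9 (f : N9 -> N9) : bool := all9 (fun y => eq9 (f (inv9 f y)) y).

(* The map al with values c', p, q at c, u, u^2, where al(x c) = al(x) c'. *)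
Definition mkal (k : trit) (a : N9 * N9 * N9) (x : N9) : N9 :=
  let: (c', p, q) := a in
  add9 k (match x.1 with Z0 => o9 | Z1 => p | Z2 => q end)
    (match x.2 with Z0 => o9 | Z1 => c' | Z2 => add9 k c' c' end).

(* (m t) m = t (delta m). *)
Definition delta (k : trit) (al : N9 -> N9) (x : N9) : N9 := add9 k (al x) x.

(* The last test is [R_t R_m R_t^-1 R_m R_t = R_n R_t R_n] read on N. *)
Definition al_ok (k : trit) (a : N9 * N9 * N9) : bool :=
  let al := memo9 (mkal k a) in
  let ia := memo9 (inv9 al) in
  let add := add9 k in
  if onto9 al then if onto9 (delta k al) then
    all9 (fun m => isSome (pick9 (fun n => all9 (fun x =>
      eq9 (al (add (ia (add (al x) m)) m)) (add (al (add x n)) n)))))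
  else false else false.

Definition seq3 := [:: Z0; Z1; Z2].
Definition seq9 : seq N9 := [seq (i, j) | i <- seq3, j <- seq3].

Definition als (k : trit) : seq (N9 * N9 * N9) :=
  [seq a <- [seq (cp, q) | cp <- [seq (c, p) | c <- seq9, p <- seq9], q <- seq9] | al_ok k a].

Definition data : Type := (N9 * N9 * N9) * (N9 * N9 * N9) * N9.

Definition shift (k : trit) (m : N9) (x : Q27) : Q27 := (x.1, add9 k x.2 m).

(* Right translation by t, for the data (al, al', n). *)
Definition mkT (k : trit) (d : data) : Q27 -> Q27 :=
  let: (a, b, n) := d in
  let al := memo9 (mkal k a) in let be := memo9 (mkal k b) in
  let ia := memo9 (inv9 al) in let ib := memo9 (inv9 be) in
  let add := add9 k in
  memo27 (fun x => match x.1 with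
    | Z0 => (Z1, al x.2)
    | Z1 => (Z2, add (be (add (ia x.2) n)) n)
    | Z2 => (Z0, ib x.2)
    end).

(* [R_t R_m R_t R_n^-1 R_t = R_n], where n is such that (t m) t = (n t^-1) n. *)
Definition data_ok (k : trit) (d : data) : bool :=
  let T := mkT k d in
  all9 (fun m => isSome (pick9 (fun n => all27 (fun x =>
    eq27 (T (shift k (opp9 k n) (T (shift k m (T x))))) (shift k n x))))).

Definition datas (k : trit) : seq data :=
  let s := als k in
  [seq d <- [seq (ab, n) | ab <- [seq (a, b) | a <- s, b <- s], n <- seq9] | data_ok k d].

(** For [l] other than [Z0], each [t_l b] is [(m t_l) m] with [delta m = b], so by the Bol identity
    its right translation is [R_m R_t R_m] or [R_m R_t^-1 R_m]; [U] inverts [T]. *)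
Definition bmul (k : trit) (d : data) : Q27 -> Q27 -> Q27 :=
  let T := mkT k d in
  let U := memo27 (fun y => odflt o27 (pick27 (fun x => eq27 (T x) y))) in
  let da := memo9 (inv9 (delta k (mkal k d.1.1))) in
  let db := memo9 (inv9 (delta k (mkal k d.1.2))) in
  let t := memo27 (fun x => memo27 (fun y => match y.1 with
    | Z0 => shift k y.2 x
    | Z1 => let m := da y.2 in shift k m (T (shift k m x))
    | Z2 => let m := db y.2 in shift k m (U (shift k m x))
    end)) in
  t.

(** * Correctness of the boolean tests and searches *)

Lemma eq3P a b : reflect (a = b) (eq3 a b).
Proof. by case: a; case: b; constructor. Qed.

Lemma eq9P a b : reflect (a = b) (eq9 a b).
Proof.
case: a b => [a b] [a' b']; rewrite /eq9 /=.
case: eq3P => [-> | nE]; last by constructor; case.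
by case: eq3P => [-> | nE]; constructor => //; case.
Qed.

Lemma eq27P a b : reflect (a = b) (eq27 a b).
Proof.
case: a b => [a b] [a' b']; rewrite /eq27 /=.
case: eq3P => [-> | nE]; last by constructor; case.
by case: eq9P => [-> | nE]; constructor => //; case.
Qed.

Lemma all3P (p : trit -> bool) : reflect (forall i, p i) (all3 p).
Proof.
rewrite /all3; case E0: (p Z0); last by constructor=> /(_ Z0); rewrite E0.
case E1: (p Z1); last by constructor=> /(_ Z1); rewrite E1.
by apply: (iffP idP) => [E2 [] | ].
Qed.

Lemma all9P (p : N9 -> bool) : reflect (forall a, p a) (all9 p).
Proof.
apply: (iffP (all3P _)) => [H [i j] | H i]; first by have /all3P := H i.
by apply/all3P.
Qed.

Lemma all27P (p : Q27 -> bool) : reflect (forall a, p a) (all27 p).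
Proof.
apply: (iffP (all3P _)) => [H [l x] | H l]; first by have /all9P := H l.
by apply/all9P.
Qed.

Lemma pick3_some A (g : trit -> option A) (P : A -> Prop) :
  (forall i x, g i = Some x -> P x) -> (exists i, isSome (g i)) ->
  exists2 x, pick3 g = Some x & P x.
Proof.
rewrite /pick3 => gP [i gi].
case E0: (g Z0) => [x|]; first by exists x => //; exact: gP E0.
case E1: (g Z1) => [x|]; first by exists x => //; exact: gP E1.
case E2: (g Z2) => [x|]; first by exists x => //; exact: gP E2.
by case: i gi; rewrite ?E0 ?E1 ?E2.
Qed.

Lemma pick9_some (p : N9 -> bool) a : p a -> exists2 b, pick9 p = Some b & p b.
Proof.
case: a => [i j] pij; apply: pick3_some => [i' x | ].
  rewrite /pick3; case: ifP => [p1 [<-] // | _].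
  by case: ifP => [p1 [<-] // | _]; case: ifP => [p1 [<-] | ].
exists i; have [|x -> //] := @pick3_some _
  (fun j => if p (i, j) then Some (i, j) else None) (fun=> True) (fun=> fun=> fun=> I).
by exists j; rewrite pij.
Qed.

Lemma pick9_mem (p : N9 -> bool) a : pick9 p = Some a -> p a.
Proof.
rewrite /pick9 /pick3; do !case: ifP => //.
all: by move=> *; congruence.
Qed.

Lemma pick27_mem (p : Q27 -> bool) a : pick27 p = Some a -> p a.
Proof.
rewrite /pick27 /pick3; case E0: (pick9 _) => [x|]; first by case=> <-; exact: (pick9_mem E0).
case E1: (pick9 _) => [x|]; first by case=> <-; exact: (pick9_mem E1).
by case E2: (pick9 _) => [x|] //; case=> <-; exact: (pick9_mem E2).
Qed.

Lemma pick27_some (p : Q27 -> bool) a : p a -> exists2 b, pick27 p = Some b & p b.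
Proof.
case: a => [l x] plx; apply: pick3_some => [l' y | ].
  by case E: (pick9 _) => [z|] // [<-]; exact: (pick9_mem E).
by exists l; have [z ->] := @pick9_some (fun x => p (l, x)) x plx.
Qed.

Lemma memo9E A (f : N9 -> A) : memo9 f =1 f.
Proof. by case=> [[] []]. Qed.

Lemma memo27E A (f : Q27 -> A) : memo27 f =1 f.
Proof. by case=> [[] [[] []]]. Qed.

Lemma inv9K (f : N9 -> N9) x : f (inv9 f (f x)) = f x.
Proof.
have [b Eb /eq9P fb] := @pick9_some (fun y => eq9 (f y) (f x)) x (introT (eq9P _ _) erefl).
by rewrite /inv9 Eb.
Qed.

Lemma eq_pick9 (p q : N9 -> bool) : p =1 q -> pick9 p = pick9 q.
Proof. by move=> E; rewrite /pick9 /pick3 !E. Qed.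

Lemma eq_inv9 (f g : N9 -> N9) : f =1 g -> inv9 f =1 inv9 g.
Proof. by move=> E y; rewrite /inv9; congr odflt; apply: eq_pick9 => x; rewrite E. Qed.

Lemma mem_seq9 a : a \in seq9.
Proof. by case: a => [[] []]. Qed.

Lemma add9C k : commutative (add9 k).
Proof. by case: k => -[[] []] [[] []]. Qed.

Lemma add9N k a : add9 k a (opp9 k a) = o9.
Proof. by case: k; case: a => [[] []]. Qed.

Lemma add90 k a : add9 k a o9 = a.
Proof. by case: k; case: a => [[] []]. Qed.

(** * Right Bol loops of prime power order *)

Section Translations.

Import GroupScope.

Record bol_loop (T : finType) (mul : T -> T -> T) (e : T) : Prop := BolLoop {
  bol_mul1 : left_id e mul;
  bol_mulr1 : right_id e mul;
  bol_injl : forall a, injective (mul a);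
  bol_injr : forall a, injective (mul^~ a);
  bol_id : right_bol mul }.

(** * Right translations, and involutions on two copies of the loop *)

Section RightBol.

Variables (T : finType) (mul : T -> T -> T) (e : T).
Hypothesis bolT : bol_loop mul e.
Local Notation "x * y" := (mul x y) : loop_scope.

Let m1x := bol_mul1 bolT.
Let mx1 := bol_mulr1 bolT.
Let injl := bol_injl bolT.
Let injr := bol_injr bolT.
Let bol := bol_id bolT.

Definition linv (y : T) : T := invF (@injl y) e.

Lemma mulVr y : (y * linv y)%L = e.
Proof. exact: f_invF. Qed.

Lemma mulKr y x : (x * y * linv y)%L = x.
Proof. by apply: (@injr y); rewrite bol mulVr m1x. Qed.

Lemma mulVl y : (linv y * y)%L = e.
Proof. by apply: (@injr (linv y)); rewrite mulKr m1x. Qed.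

Lemma mulVKr y x : (x * linv y * y)%L = x.
Proof.
have linvK : linv (linv y) = y by apply: (@injl (linv y)); rewrite mulVr mulVl.
by rewrite -{2}linvK mulKr.
Qed.

Definition rtr (y : T) : {perm T} := perm (@injr y).

Lemma rtrE y x : rtr y x = (x * y)%L.
Proof. by rewrite permE. Qed.

Lemma rtr_inj : injective rtr.
Proof. by move=> x y /permP/(_ e); rewrite !rtrE !m1x. Qed.

Lemma rtr1 : rtr e = 1.
Proof. by apply/permP=> x; rewrite rtrE perm1 mx1. Qed.

Lemma rtrV y : rtr (linv y) = (rtr y)^-1.
Proof.
apply: (mulIg (rtr y)); rewrite mulVg; apply/permP=> x.
by rewrite permM !rtrE perm1 mulVKr.
Qed.

Lemma rtr_bol y z : rtr y * rtr z * rtr y = rtr (y * z * y)%L.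
Proof. by apply/permP=> x; rewrite !permM !rtrE bol. Qed.

(** The induction goes by twos, since [R_y R_z R_y] is again a right translation. *)
Lemma rtrX y n : rtr y ^+ n = rtr ((rtr y ^+ n) e).
Proof.
suff [z ->] : exists z, rtr y ^+ n = rtr z by rewrite rtrE m1x.
elim/ltn_ind: n => -[|[|n]] IHn; first by exists e; rewrite rtr1.
  by exists y; rewrite expg1.
have [z Ez] := IHn n (ltnW (ltnSn _)).
by exists (y * z * y)%L; rewrite -rtr_bol -Ez expgSr expgS.
Qed.

Lemma rtr_fix y x : rtr y x = x -> y = e.
Proof. by rewrite rtrE -{2}[x]mx1 => /injl. Qed.

(** Powers of [rtr y] are right translations, which have no fixed points unless trivial; so all
    orbits of [<[rtr y]>] have size [#[rtr y]]. *)
Lemma order_rtr y : #[rtr y] %| #|T|.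
Proof.
have actsT : [acts <[rtr y]>, on [set: T] | 'P].
  by apply/actsP=> a _ x; rewrite !inE.
rewrite -cardsT (card_uniform_partition (n := #[rtr y]) _ (orbit_partition actsT)).
  exact: dvdn_mull.
move=> _ /imsetP[x _ ->]; rewrite card_orbit orderE.
rewrite (_ : 'C_<[rtr y]>[x | 'P] = 1) ?indexg1 //; apply/trivgP/subsetP=> s.
rewrite inE => /andP[/cycleP[n ->]] /astab1P /=.
by rewrite apermE rtrX => /rtr_fix ->; rewrite rtr1 inE.
Qed.


Definition flip_fun (k : T) (u : bool * T) : bool * T :=
  (~~ u.1, if u.1 then (u.2 * linv k)%L else (u.2 * k)%L).

Lemma flip_funK k : involutive (flip_fun k).
Proof. by case=> -[] x; rewrite /flip_fun /= ?mulKr ?mulVKr. Qed.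

Definition flip k : {perm bool * T} := perm (inv_inj (flip_funK k)).

Lemma flipE k b x :
  flip k (b, x) = (~~ b, if b then (x * linv k)%L else (x * k)%L).
Proof. by rewrite permE. Qed.

Lemma flip_inj : injective flip.
Proof. by move=> x y /permP/(_ (false, e)); rewrite !flipE !m1x => -[]. Qed.

Lemma flip2 k : flip k * flip k = 1.
Proof. by apply/permP=> -[b x]; rewrite permM !permE flip_funK. Qed.

Lemma flipV k : (flip k)^-1 = flip k.
Proof. by apply: (mulgI (flip k)); rewrite mulgV flip2. Qed.

Lemma linvK y : linv (linv y) = y.
Proof. by apply: (@injl (linv y)); rewrite mulVr mulVl. Qed.

Lemma linv1 : linv e = e.
Proof. by rewrite -{2}(mulVr e) m1x. Qed.

Lemma linv_bol k l : linv (k * linv l * k)%L = (linv k * l * linv k)%L.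
Proof.
apply: rtr_inj; rewrite rtrV -!rtr_bol !invMg !rtrV mulgA.
by rewrite invgK.
Qed.

(** On the copy [false] this is the Bol identity, on the copy [true] its inverted form. It makes the
    set of flips closed under conjugation by flips. *)
Lemma flip_conj k l : flip l ^ flip k = flip (k * linv l * k)%L.
Proof.
rewrite conjgE flipV; apply/permP=> -[[] x]; rewrite !permM !flipE /=.
  by rewrite linv_bol bol.
by rewrite bol.
Qed.

End RightBol.

(** * A Sylow subgroup normalised by an involution *)

Lemma p_elts_pgroup (gT : finGroupType) (p : nat) (G : {group gT}) :
  (forall x, x \in G -> p.-elt x) -> p.-group G.
Proof.
move=> pG; apply/pgroupP=> q pr_q /(Cauchy pr_q)[x Gx ox].
by have := pG x Gx; rewrite /p_elt ox pnatE.
Qed.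

(* Both cases of the proof enlarge a maximal s-invariant p-subgroup P inside
   'N_H(P): if s centralises 'N_H(P) modulo P then every larger p-subgroup of
   'N_H(P) is invariant, and otherwise some s * s ^ g outside P is inverted by
   s. *)
Lemma Sylow_norm_involution (gT : finGroupType) (p : nat) (H : {group gT}) (s : gT) :
    s \in H -> s * s = 1 -> (forall g, g \in H -> p.-elt (s * s ^ g)) ->
  exists2 P : {group gT}, p.-Sylow(H) P & s \in 'N(P).
Proof.
move=> Hs ss1 ps.
pose good (P : {group gT}) := [&& p.-group P, P \subset H & s \in 'N(P)].
have good1 : good 1%G by rewrite /good pgroup1 sub1G norm1 inE.
have [P /maxgroupP[/and3P[pP sPH nPs] maxP] _] := maxgroup_exists good1.
exists P => //.
have [S sylS sPS] := Sylow_superset sPH pP.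
have [-> // | neqPS] := eqVneq P S.
have pS := pHall_pgroup sylS.
have prPS : P \proper S.
  by rewrite properEneq sPS andbT; apply: contraNneq neqPS => /val_inj->.
have := nilpotent_proper_norm (pgroup_nil pS) prPS.
pose S' := 'N_S(P)%G => prPS'.
have sV : s^-1 = s by apply: (mulgI s); rewrite mulgV ss1.
have [cent | ] := boolP [forall g in 'N_H(P), s * s ^ g \in P].
  have : good S'.
    rewrite /good (pgroupS _ pS) ?subsetIl // subIset ?(pHall_sub sylS) //=.
    rewrite inE; apply/subsetP=> _ /imsetP[g S'g ->].
    have [Sg Ng] := setIP S'g.
    have Hg : g \in 'N_H(P) by rewrite inE (subsetP (pHall_sub sylS)) // Ng.
    have := forall_inP cent _ Hg; rewrite !conjgE sV => sP.
    (* This writes [g ^ s] as [g] times the inverse of [s * s ^ g], an element of [P]. *)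
    have -> : s * (g * s) = g * (s * (g^-1 * (s * g)))^-1.
      by rewrite !invMg sV invgK !mulgA mulgV mul1g.
    by rewrite groupM // groupV (subsetP (proper_sub prPS')).
  by move/maxP => /(_ (proper_sub prPS')) E; rewrite E properxx in prPS'.
case/forall_inPn=> g /setIP[Hg Ng] nPy.
set y := s * s ^ g in nPy.
have Ny : y \in 'N(P) by rewrite groupM // groupJ.
have yJ : y ^ s = y^-1.
  by rewrite /y !conjgE !invMg !invgK sV !mulgA ss1 mul1g.
pose Y := (P <*> <[y]>)%G.
have sYN : <[y]> \subset 'N(P) by rewrite cycle_subG.
have : good Y.
  rewrite /good join_subG sPH cycle_subG groupM ?groupJ //=.
  rewrite -sub1set normsY ?sub1set // ?andbT; last first.
    by rewrite inE -cycleJ yJ cycleV.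
  by rewrite norm_joinEr // pgroupM pP [p.-group _]ps.
move/maxP=> /(_ (joing_subl _ _)) EY.
by case/negP: nPy; rewrite -EY -cycle_subG joing_subr.
Qed.

(** * In odd prime power order the right translations generate a p-group *)

Section PPower.

Variables (T : finType) (mul : T -> T -> T) (e : T) (p n : nat).
Hypotheses (bolT : bol_loop mul e) (pr_p : prime p) (odd_p : odd p).
Hypothesis cardT : #|T| = (p ^ n)%N.
Local Notation "x * y" := (mul x y) : loop_scope.
Local Notation rtr := (rtr bolT).
Local Notation flip := (flip bolT).
Local Notation linv := (linv bolT).

Lemma rtr_exp_card y : rtr y ^+ (p ^ n) = 1.
Proof. by apply/eqP; rewrite -order_dvdn -cardT order_rtr. Qed.

Lemma p_elt_expn (gT : finGroupType) (x : gT) : x ^+ (p ^ n) = 1 -> p.-elt x.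
Proof.
move/eqP; rewrite -order_dvdn => ox.
by apply: pnat_dvd ox _; rewrite pnatX pnat_id.
Qed.

(** The product preserves both copies, acting as [rtr l] on the copy [true] and as its inverse on
    the copy [false]. *)
Lemma flip1_mul_elt l : p.-elt (flip e * flip l).
Proof.
apply: p_elt_expn.
have E m b x : ((flip e * flip l) ^+ m) (b, x) =
    (b, (rtr (if b then l else linv l) ^+ m) x).
  elim: m x => [|m IHm] x; first by rewrite !expg0 !perm1.
  rewrite !expgSr !permM IHm !flipE negbK rtrE linv1 (bol_mulr1 bolT).
  by case: (b).
apply/permP=> -[b x].
by rewrite E rtr_exp_card !perm1.
Qed.

Lemma bol_root k : exists h, (h * h)%L = k.
Proof.
(* As [p ^ n] is odd, [2 * m] is [p ^ n + 1], so [rtr k] raised to [2 * m] is [rtr k]. *)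
pose m := (p ^ n).+1./2; pose h := (rtr k ^+ m) e; exists h.
apply: (@rtr_inj _ _ _ bolT); rewrite -{1}(bol_mulr1 bolT h).
rewrite -rtr_bol rtr1 mulg1 -rtrX -expgD addnn.
rewrite /m halfK /= oddX odd_p orbT /= subn0.
by rewrite expgS rtr_exp_card mulg1.
Qed.

Lemma flip_root k : exists h, flip k = flip e ^ flip h.
Proof.
have [h <-] := bol_root k; exists h.
by rewrite flip_conj linv1 (bol_mulr1 bolT).
Qed.

(** Conjugation by [flip h] turns the first factor into [flip e] and the second into another
    flip. *)
Lemma flip_mul_elt k l : p.-elt (flip k * flip l).
Proof.
have [h ->] := flip_root k.
rewrite -(p_eltJ p _ (flip h)) conjMg -conjgM flip2 conjg1 flip_conj.
exact: flip1_mul_elt.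
Qed.

Let H := <<[set flip k | k : T]>>%G.
Let D := [set flip k | k : T].

Let Hflip k : flip k \in H.
Proof. by rewrite mem_gen ?imset_f. Qed.

Lemma class_flip : flip e ^: H = D.
Proof.
apply/eqP; rewrite eqEsubset; apply/andP; split; last first.
  apply/subsetP=> _ /imsetP[k _ ->]; have [h ->] := flip_root k.
  by rewrite imset_f.
have /subsetP nDH : H \subset 'N(D).
  rewrite gen_subG; apply/subsetP=> _ /imsetP[k _ ->].
  rewrite inE; apply/subsetP=> _ /imsetP[_ /imsetP[l _ ->] ->].
  by rewrite flip_conj imset_f.
apply/subsetP=> _ /imsetP[g /nDH Hg ->].
by rewrite memJ_norm // imset_f.
Qed.

(* Conjugation by the Sylow subgroup P normalised by flip e is transitive on the
   flips because their number is a power of p. *)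
Lemma flip_pgroup : exists2 P : {group {perm bool * T}},
  p.-group P & forall k, flip e * flip k \in P.
Proof.
have [g Hg | P sylP nPs] := @Sylow_norm_involution _ p H (flip e) (Hflip e) (flip2 bolT e).
  have /imsetP[k _ ->] : flip e ^ g \in D by rewrite -class_flip imset_f.
  exact: flip_mul_elt.
exists P => [|k]; first exact: pHall_pgroup sylP.
have EH : 'C_H[flip e] * P = H.
  apply: coprime_index_mulG; rewrite ?subsetIl ?(pHall_sub sylP) //.
  rewrite index_cent1 class_flip card_imset; last exact: flip_inj.
  rewrite cardT; apply: (@pnat_coprime p); first by rewrite pnatX pnat_id.
  by case/and3P: sylP.
have /imsetP[g] : flip k \in flip e ^: H by rewrite class_flip imset_f.
rewrite -{1}EH => /mulsgP[c q /setIP[_ /cent1P cc] Pq ->] ->.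
rewrite conjgM (_ : flip e ^ c = flip e); last by rewrite conjgE -cc mulKg.
(* The product is the commutator of [flip e] and [q]; it lies in [P] because [flip e] normalises
   [P]. *)
rewrite -{1}(flipV bolT e) -commgEl commgEr groupMr //.
by rewrite memJ_norm ?groupV.
Qed.

Definition rmlt : {group {perm T}} := <<[set rtr k | k : T]>>%G.

Lemma mem_rmlt k : rtr k \in rmlt.
Proof. by rewrite mem_gen ?imset_f. Qed.

Lemma rmlt_pgroup : p.-group rmlt.
Proof.
have [P pP flipP] := flip_pgroup.
(* [A] collects the permutations that members of [P] induce on the copy [true]; [rtr k] comes from
   [flip e * flip k]. *)
pose A := [set g : {perm T} | [exists h in P, [forall x, h (true, x) == (true, g x)]]].
have gA : group_set A.
  apply/group_setP; split=> [|g g'].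
    by rewrite inE; apply/exists_inP; exists 1 => //; apply/forallP=> x; rewrite !perm1.
  rewrite !inE => /exists_inP[h Ph /forallP gh] /exists_inP[h' Ph' /forallP gh'].
  apply/exists_inP; exists (h * h'); rewrite ?groupM //; apply/forallP=> x.
  by rewrite !permM (eqP (gh x)) (eqP (gh' _)).
have sGA : rmlt \subset Group gA.
  rewrite gen_subG; apply/subsetP=> _ /imsetP[k _ ->]; rewrite inE.
  apply/exists_inP; exists (flip e * flip k) => //; apply/forallP=> x.
  by rewrite permM !flipE rtrE linv1 (bol_mulr1 bolT).
apply: pgroupS sGA _; apply: p_elts_pgroup => g.
rewrite inE => /exists_inP[h Ph /forallP gh].
have gh' m x : (h ^+ m) (true, x) = (true, (g ^+ m) x).
  elim: m x => [|m IHm] x; first by rewrite !expg0 !perm1.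
  by rewrite !expgSr !permM IHm (eqP (gh _)).
apply: pnat_dvd (mem_p_elt pP Ph); rewrite order_dvdn; apply/eqP/permP=> x.
by have := gh' #[h] x; rewrite expg_order !perm1 => -[].
Qed.

End PPower.

(** * A normal subloop of index p with a left nuclear element of order p *)

Section Structure.

Variables (T : finType) (mul : T -> T -> T) (e : T) (p n : nat).
Hypotheses (bolT : bol_loop mul e) (pr_p : prime p) (odd_p : odd p).
Hypotheses (cardT : #|T| = (p ^ n)%N) (n_gt1 : 1 < n).
Local Notation "x * y" := (mul x y) : loop_scope.
Local Notation rtr := (rtr bolT).
Local Notation G := (rmlt bolT).

(* The kernel of f comes from a maximal subgroup M of the p-group [rmlt] above
   the stabiliser of e, and left multiplication by c is a central element of
   [rmlt] lying in M. *)
Lemma bol_p_structure : exists (gT : finGroupType) (f : T -> gT) (c : T),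
  [/\ {morph f : x y / (x * y)%L >-> x * y}, forall x, f x ^+ p = 1
    & (#|[set x | f x == 1%g]| * p = #|T|)%N] /\
  [/\ c != e, f c = 1, (forall x y, c * (x * y) = c * x * y)%L
    & iter p (mul c) e = e].
Proof.
have pG : p.-group G := rmlt_pgroup bolT pr_p odd_p cardT.
pose S := 'C_G[e | 'P]%G.
have orbG : orbit 'P G e = [set: T].
  apply/setP=> x; rewrite inE; apply/orbitP; exists (rtr x); first exact: mem_rmlt.
  by rewrite /= apermE rtrE (bol_mul1 bolT).
have oS : #|G : S| = (p ^ n)%N by rewrite -card_orbit orbG cardsT.
have [EGS | [M maxM sSM]] := @maximal_exists _ S G (subsetIl _ _).
  move: oS; rewrite EGS indexgg => /eqP; rewrite eq_sym -(expn0 p).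
  by rewrite eqn_exp2l ?prime_gt1 // => /eqP n0; move: n_gt1; rewrite n0.
have nMG := p_maximal_normal pG maxM; have oM := p_maximal_index pG maxM.
have sMG := normal_sub nMG.
(* Permutations in [G] that agree at [e] differ by an element of the stabiliser, hence of [M]. This
   gives both the multiplicativity of [f] and its kernel. *)
have Ssub x y g : g \in G -> g e = x -> y = x -> rtr y * g^-1 \in M.
  move=> Gg <- ->; apply: (subsetP sSM); rewrite inE groupM ?groupV ?mem_rmlt //=.
  by apply/astab1P; rewrite /= apermE permM rtrE (bol_mul1 bolT) permK.
have nMr x : rtr x \in 'N(M) by rewrite (subsetP (normal_norm nMG)) ?mem_rmlt.
have oMS : (#|M : S| * p = #|T|)%N.
  by rewrite -oM cardT -oS mulnC Lagrange_index.
pose f x : coset_of M := coset M (rtr x).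
have f1 x : (f x == 1%g) = (rtr x \in M).
  apply/eqP/idP; last exact: coset_id.
  by rewrite /f => /coset_idr ->.
have kerM x : (rtr x \in M) = (x \in orbit 'P M e).
  apply/idP/orbitP => [Mx | [g Mg gx]].
    by exists (rtr x) => //=; rewrite apermE rtrE (bol_mul1 bolT).
  by rewrite -(mulgKV g (rtr x)) groupMr // (@Ssub x) ?(subsetP sMG).
have SM : 'C_M[e | 'P] = S.
  by apply/eqP; rewrite eqEsubset subsetI sSM subsetIr setSI.
have cker : (#|[set x | f x == 1%g]| * p = #|T|)%N.
  rewrite -oMS -SM -card_orbit; congr (_ * _)%N; apply: eq_card => x.
  by rewrite inE f1 kerM.
(* A trivial [M] would give [#|T| = p] by [oMS], against [1 < n]. *)
have ntM : M :!=: 1.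
  apply/eqP=> M1; move: oMS; rewrite M1.
  have -> : #|1 : S| = 1%N by apply/eqP; rewrite -dvdn1 -(cards1 (1 : {perm T})) dvdn_indexg.
  rewrite mul1n cardT -{1}(expn1 p) => /eqP.
  by rewrite eqn_exp2l ?prime_gt1 // => /eqP n1; move: n_gt1; rewrite -n1.
have pZ : p %| #|M :&: 'Z(G)|.
  have ntZ := meet_center_nil (pgroup_nil pG) nMG ntM.
  have sZ : M :&: 'Z(G) \subset G by rewrite subIset ?sMG.
  by have [] := pgroup_pdiv (pgroupS sZ pG) ntZ.
have [z /setIP[Mz Zz] oz] := Cauchy pr_p pZ.
(* [z] commutes with [rtr x], and [x] is the value of [rtr x] at [e]. *)
have zE x : z x = (z e * x)%L.
  rewrite -(rtrE bolT) -permM -(centerC (mem_rmlt bolT x) Zz) permM rtrE.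
  by rewrite (bol_mul1 bolT).
exists _, f, (z e); split; split=> //.
- move=> x y; rewrite /f -morphM ?nMr // -[in LHS](mulgKV (rtr x * rtr y) (rtr _)).
  apply: coset_kerl; apply: (Ssub _ _ _ (groupM (mem_rmlt bolT x) (mem_rmlt bolT y))) erefl _.
  by rewrite permM !rtrE (bol_mul1 bolT).
- move=> x; apply/eqP; rewrite -order_dvdn -oM -card_quotient ?(normal_norm nMG) //.
  by rewrite order_dvdG ?mem_quotient ?mem_rmlt.
- apply: contraTneq (prime_gt1 pr_p) => ze; rewrite -oz.
  suff -> : z = 1 by rewrite order1.
  by apply/permP=> x; rewrite zE ze (bol_mul1 bolT) perm1.
- by apply/eqP; rewrite f1 kerM; apply/orbitP; exists z.
- by move=> x y; rewrite -!zE -!(rtrE bolT) -!permM (centerC (mem_rmlt bolT y) Zz).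
rewrite (_ : iter _ _ _ = (z ^+ p) e) ?permX; last exact: eq_iter.
by rewrite -permX -oz expg_order perm1.
Qed.

End Structure.

(** * Right Bol loops of order 9 *)

Section Order9.

Variables (T : finType) (mul : T -> T -> T) (e : T).
Hypotheses (bolT : bol_loop mul e) (cardT : #|T| = 9).
Local Notation "x * y" := (mul x y) : loop_scope.
Local Open Scope loop_scope.

(** Every element is some [zp i] applied to [e], [t] or [t * t], with [z] the left multiplication by
    [c]. Once [z] passes through both factors of a product, both laws reduce to powers of [t]. *)
Lemma bol9_abelian : associative mul /\ commutative mul.
Proof.
have [] := @bol_p_structure T mul e 3 2 bolT isT isT cardT isT.
move=> gT [f [c [[fM f3 cker] [c_neq1 fc nuc]]]].
rewrite /= (bol_mulr1 bolT) => ccc1.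
have [z zE] : exists z, forall x, z x = c * x by exists (mul c).
have m1x := bol_mul1 bolT; have mx1 := bol_mulr1 bolT; have bol := bol_id bolT.
have z_mul x y : z (x * y) = z x * y by rewrite !zE nuc.
have zzz x : z (z (z x)) = x by rewrite -{1}(m1x x) !z_mul !zE mx1 ccc1 m1x.
have z_fix x : z x <> x.
  rewrite -{1}(m1x x) z_mul zE mx1 -{2}(m1x x) => /(bol_injr bolT) Ec.
  by rewrite Ec eqxx in c_neq1.
have zz_fix x : z (z x) <> x by move=> E; apply: (@z_fix x); rewrite -{1}E zzz.
have fz x : f (z x) = f x by rewrite zE fM fc mul1g.
have f1 : f e = 1 by apply: (mulgI (f e)); rewrite -fM m1x mulg1.
pose zp i x := match i with Z0 => x | Z1 => z x | Z2 => z (z x) end.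
have fzp i x : f (zp i x) = f x by case: i; rewrite /= ?fz.
have zp_inj x : injective (zp^~ x).
  by move=> [] [] //= => [/esym/z_fix|/esym/zz_fix|/z_fix|/esym/z_fix|/zz_fix|/z_fix].
have [t ft] : exists t, f t != 1.
  case: (pickP (fun t => f t != 1)) => [t ft|fT]; first by exists t.
  move: cker; rewrite (eq_card (B := T)) ?cardT // => x.
  by rewrite !inE; apply: negbFE (fT x).
pose tp t l := match l with Z0 => e | Z1 => t | Z2 => t * t end.
have f3' s : (f s * f s * f s)%g = 1 by rewrite -(f3 s) expgSr expgS expg1.
have fttt s : f (s * s * s) = 1 by rewrite !fM f3'.
have lab s : f s != 1 -> forall x, exists li : trit * trit, zp li.2 (tp s li.1) = x.
  move=> fs; apply: inj_onto; last by rewrite card_prod card_trit cardT.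
  move=> [l i] [l' i'] /= E.
  suff El : l = l' by move: E; rewrite El => /zp_inj ->.
  have fss : f (s * s) <> 1.
    rewrite fM => E2; move/eqP: fs; apply.
    by have := f3' s; rewrite E2 mul1g.
  have fs' : f s <> 1 by exact/eqP.
  have fss' : f (s * s) <> f s.
    by rewrite fM -{3}(mulg1 (f s)) => /mulgI.
  move/(congr1 f): E; rewrite !fzp.
  by case: l; case: l' => //=; rewrite ?f1 => // E; exfalso; move: fs' fss fss'; rewrite ?E // -?E.
have Nz x : f x = 1 -> x * c = z x.
  have [[l i] <-] := lab t ft x; rewrite fzp => /= fl.
  have -> : tp t l = e.
    have [[l' i'] El] := lab t ft (tp t l).
    case: l fl {El} => //= fl; first by rewrite fl eqxx in ft.
    exfalso; move/eqP: ft; apply.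
    by have := f3' t; rewrite -fM fl mul1g.
  by case: i; rewrite /= -?z_mul m1x !zE mx1.
have cz x : x * c = z x.
  have [/eqP /Nz // | fx] := boolP (f x == 1).
  have [[l i] /= xc] := lab x fx (x * c).
  have fxc : f (x * c) = f x by rewrite fM fc mulg1.
  have El : l = Z1.
    move/(congr1 f): xc; rewrite fzp fxc.
    case: l => //=; first by rewrite f1 => E; rewrite -E eqxx in fx.
    by rewrite fM -{3}(mulg1 (f x)) => /mulgI E; rewrite E eqxx in fx.
  rewrite {}El /= in xc.
  case: i xc => /= xc; [| by rewrite -xc |].
    by move: c_neq1; rewrite -(inj_eq (@bol_injl _ _ _ bolT x)) mx1 -xc eqxx.
  (* The case left is [x * c = z (z x)]. Here [key] at [x] gives [x * x * c = z (x * x)], and then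
     [key] at [x * x] makes [z \o z] fix [x * x * x]. *)
  have key w : w * c * x * c = w * x by rewrite bol -[c * x]zE -z_mul -xc zzz.
  have xxc : x * x * c = z (x * x).
    by have E := key x; rewrite -xc -!z_mul in E; rewrite -[in RHS]E zzz.
  have := key (x * x); rewrite xxc -!z_mul (Nz _ (fttt x)).
  by move/zz_fix.
have zr x y : x * z y = z (x * y).
  (* The Bol identity with [c] moves [z] only two at a time; as [z] has order 3, it equals its
     fourth power, and two such moves suffice. *)
  have zzr w : x * z (z w) = z (z (x * w)).
    by have := bol x c w; rewrite !cz -zE -z_mul => <-.
  by rewrite -[in LHS](zzz (z y)) !zzr zzz.
have zpr i x y : x * zp i y = zp i (x * y) by case: i; rewrite /= ?zr.
have zpl i x y : zp i x * y = zp i (x * y) by case: i; rewrite /= -?z_mul.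
have ralt x : x * (t * t) = x * t * t.
  by have := bol x t e; rewrite !mx1.
have A1 x y : x * y * t = x * (y * t).
  have [[l i] <-] := lab t ft y; rewrite zpl !zpr zpl; congr (zp i _).
  by case: l => /=; rewrite ?mx1 ?m1x // ?ralt // bol.
have A x y w : x * (y * w) = x * y * w.
  have [[l i] <-] := lab t ft w; rewrite !zpr; congr (zp i _).
  by case: l => /=; rewrite ?mx1 ?A1 // !ralt (A1 x y) (A1 x (y * t)).
split=> // x y.
have [[l i] <-] := lab t ft x; have [[l' i'] <-] := lab t ft y.
rewrite !zpl !zpr.
have -> : tp t l * tp t l' = tp t l' * tp t l.
  by case: l; case: l' => //=; rewrite ?mx1 ?m1x // ?A // A.
by case: i; case: i'.
Qed.

End Order9.

(** * Coordinates on a right Bol loop of order 27 *)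

Section Kernel9.

Variables (T : finType) (mul : T -> T -> T) (e : T) (gT : finGroupType) (f : T -> gT).
Hypothesis bolT : bol_loop mul e.
Local Notation "x * y" := (mul x y) : loop_scope.
Hypothesis fM : {morph f : x y / (x * y)%L >-> x * y}.
Hypothesis card_ker : #|[set x | f x == 1%g]| = 9.
Local Open Scope loop_scope.

Let K := {x : T | f x == 1%g}.

Let cardK : #|{: K}| = 9.
Proof. by rewrite card_sig -card_ker; apply: eq_card => x; rewrite !inE. Qed.

Let m1x := bol_mul1 bolT.
Let mx1 := bol_mulr1 bolT.
Let bol := bol_id bolT.

Lemma ker1 : f e = 1%g.
Proof. by apply: (mulgI (f e)); rewrite -fM m1x mulg1. Qed.

Let e9 : K := Sub e (introT eqP ker1).

Let ldiv x y := invF (@bol_injl _ _ _ bolT x) y.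

Let ldivK x y : x * ldiv x y = y.
Proof. exact: f_invF. Qed.

Lemma op_subproof p (a b : K) : f (ldiv p (p * val a * val b)) == 1%g.
Proof.
apply/eqP/(mulgI (f p)); rewrite -fM ldivK !fM.
by rewrite (eqP (valP a)) (eqP (valP b)) !mulg1.
Qed.

(* The isotope of the kernel obtained by transporting its action on the coset of p. *)
Let op p (a b : K) : K := Sub (ldiv p (p * val a * val b)) (op_subproof p a b).

Let opE p a b : p * val (op p a b) = p * val a * val b.
Proof. by rewrite ldivK. Qed.

(** The Bol identity makes the right side free of [p]. *)
Let val_op_bol p a b : val (op p (op p a b) a) = val a * val b * val a.
Proof. by apply: (bol_injl bolT (a := p)); rewrite !opE bol. Qed.

Let bol_op p : bol_loop (op p) e9.
Proof.
have inj_p := @bol_injl _ _ _ bolT p.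
split=> [a|a|a b b'|b a a'|x y z].
- by apply/val_inj/inj_p; rewrite opE /= mx1.
- by apply/val_inj/inj_p; rewrite opE /= mx1.
- move/(congr1 (fun v => p * val v)); rewrite !opE => /(bol_injl bolT).
  exact: val_inj.
- move/(congr1 (fun v => p * val v)); rewrite /= !opE => /(bol_injr bolT) /inj_p.
  exact: val_inj.
by apply/val_inj/inj_p; rewrite !opE bol val_op_bol.
Qed.

Let op_abelian p := bol9_abelian (bol_op p) cardK.

(** If [h] is a square root of [a], the product of [a] and [b] in an abelian group is that of [h],
    [b] and [h], which is free of [p] by [val_op_bol]. With [b] trivial this shows that [h] is a
    root of [a] for every [op p]. *)
Let op_indep p a b : op p a b = op e a b.
Proof.
have [h <-] := @bol_root _ _ _ 3 2 (bol_op e) isT cardK a.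

have sq : op p h h = op e h h.
  apply/val_inj; have := val_op_bol p h e9; have := val_op_bol e h e9.
  by rewrite !(bol_mulr1 (bol_op _)) => -> ->.
have sqE q : op q (op q h h) b = op q (op q h b) h.
  by have [A C] := op_abelian q; rewrite -A (C h (op q h b)).
by rewrite sqE -{1}sq sqE; apply/val_inj; rewrite !val_op_bol.
Qed.

Lemma ker_act x a b : f a = 1%g -> f b = 1%g -> x * a * b = x * (a * b).
Proof.
move=> /eqP fa /eqP fb.
have := opE x (Sub a fa) (Sub b fb); rewrite op_indep => <-; congr (_ * _).
by have := opE e (Sub a fa) (Sub b fb); rewrite !m1x.
Qed.

Lemma ker_comm a b : f a = 1%g -> f b = 1%g -> a * b = b * a.
Proof.
move=> /eqP fa /eqP fb; have [_ C1] := op_abelian e.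
have := opE e (Sub a fa) (Sub b fb); rewrite C1 opE !m1x /=.
by move=> ->.
Qed.

End Kernel9.

(** * Generators of the kernel *)

Section KernelCoordinates.

Variables (T : finType) (mul : T -> T -> T) (e : T) (gT : finGroupType) (f : T -> gT).
Hypothesis bolT : bol_loop mul e.
Local Notation "x * y" := (mul x y) : loop_scope.
Hypothesis fM : {morph f : x y / (x * y)%L >-> x * y}.
Hypothesis card_ker : #|[set x | f x == 1%g]| = 9.
Variable c : T.
Hypotheses (fc : f c = 1) (c_neq1 : c != e) (ccc : (c * (c * c) = e)%L).
Local Notation rtr := (rtr bolT).

Lemma kernel_coordinates : exists (k : trit) (U : N9 -> T),
  [/\ k = Z0 \/ k = Z1, U o9 = e /\ U (Z0, Z1) = c, injective U,
      forall a, f (U a) = 1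
    & forall x a b, (x * U a * U b = x * U (add9 k a b))%L].
Proof.
have m1x := bol_mul1 bolT; have mx1 := bol_mulr1 bolT.
have f1 : f e = 1 := ker1 bolT fM.
have rtrM a b : f a = 1 -> f b = 1 -> rtr a * rtr b = rtr (a * b)%L.
  move=> fa fb; apply/permP=> x; rewrite permM !rtrE.
  exact: (ker_act bolT fM card_ker).
pose A := [set rtr m | m in [set x | f x == 1]].
have memA m : f m = 1 -> rtr m \in A by move=> fm; rewrite imset_f ?inE ?fm.
have gA : group_set A.
  apply/group_setP; split=> [|g h]; first by rewrite -(rtr1 bolT) memA.
  case/imsetP=> a; rewrite inE => /eqP fa ->; case/imsetP=> b; rewrite inE => /eqP fb ->.
  by rewrite rtrM // memA // fM fa fb mul1g.
pose B := Group gA.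
have cB : abelian B.
  apply/centsP=> _ /imsetP[a + ->] _ /imsetP[b + ->]; rewrite !inE => /eqP fa /eqP fb.
  by rewrite /commute !rtrM // (ker_comm bolT fM card_ker).
have oB : #|B| = 9 by rewrite card_imset //; exact: rtr_inj.
have BV g : g \in B -> rtr (g e) = g /\ f (g e) = 1.
  by case/imsetP=> a; rewrite inE => /eqP fa ->; rewrite rtrE m1x.
pose s := rtr c; have Bs : s \in B by exact: memA.
have s3 : s ^+ 3 = 1.
  by rewrite !expgS expg0 mulg1 !rtrM ?fM ?fc ?mul1g // ccc rtr1.
have os : #[s] = 3.
  apply: nt_prime_order => //; rewrite -(rtr1 bolT); apply: contraNneq c_neq1.
  by move/rtr_inj ->.
have nsB : <[s]> <| B by rewrite -sub_abelian_normal // cycle_subG.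
have oBs : #|B / <[s]>| = 3.
  by rewrite card_quotient ?normal_norm // -divgS ?normal_sub // oB -orderE os.
have cube v : v \in B -> v ^+ 3 \in <[s]>.
  move=> Bv; have Nv : v \in 'N(<[s]>) by rewrite (subsetP (normal_norm nsB)).
  apply: coset_idr; rewrite ?groupX // morphX // -oBs.
  by apply/eqP; rewrite -order_dvdn order_dvdG ?mem_quotient.
have [v Bv nsv] : exists2 v, v \in B & v \notin <[s]>.
  apply/subsetPn/negP=> /subset_leq_card; rewrite oB -orderE os //.
have sqn w : w \in B -> w \notin <[s]> -> w ^+ 2 \notin <[s]>.
  move=> Bw; apply: contra => w2; have := groupX 2 w2.
  by rewrite -expgM (expgD w 1 3) groupMr ?cube.
have [k [u [kE Bu nsu u3]]] : exists k u,
    [/\ k = Z0 \/ k = Z1, u \in B, u \notin <[s]> & u ^+ 3 = s ^+ nat_of_trit k].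
  have := cube v Bv; case/cyclePmin=> -[|[|[|]]] //; rewrite os // => _ v3.
  - by exists Z0, v; split=> //; left.
  - by exists Z1, v; split=> //; right.
  (* If [v ^+ 3] is [s ^+ 2], then [v ^+ 2] has cube [s ^+ 4 = s]. *)
  exists Z1, (v ^+ 2); split; [by right | exact: groupX | exact: sqn |].
  by rewrite -expgM mulnC expgM v3 -expgM (expgD s 1 3) s3 mulg1.
pose U (a : N9) := u ^+ nat_of_trit a.1 * s ^+ nat_of_trit a.2.
have BU a : U a \in B by rewrite groupM ?groupX.
have us : commute u s by exact: (centsP cB).
have UM a b : U a * U b = U (add9 k a b).
  rewrite /U -mulgA (mulgA (s ^+ _)) -(commuteX2 _ _ us) !mulgA -expgD -mulgA -expgD.
  have -> : u ^+ (nat_of_trit a.1 + nat_of_trit b.1) =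
      u ^+ nat_of_trit (add3 a.1 b.1) * s ^+ nat_of_trit (carry k a.1 b.1).
    have E n : u ^+ (3 + n) = u ^+ n * s ^+ nat_of_trit k.
      by rewrite expgD u3 (commuteX2 _ _ us).
    by case: a.1; case: b.1; first [exact: (E 0%N) | exact: (E 1%N) | rewrite /= (expg0 s) mulg1].
  rewrite -mulgA -expgD; congr (_ * _).
  have E n : s ^+ (3 + n) = s ^+ n by rewrite expgD s3 mul1g.
  rewrite /add9 /=; move: (carry k a.1 b.1) a.2 b.2 => l j j'.
  by case: j; case: j'; case: l;
    first [done | exact: (E 0%N) | exact: (E 1%N) | exact: (E 2) | exact: etrans (E 3) (E 0%N)].
have injU : injective U.
  move=> [i j] [i' j'] E.
  have Nu : u \in 'N(<[s]>) by rewrite (subsetP (normal_norm nsB)).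
  have Ns n : s ^+ n \in 'N(<[s]>) by rewrite (subsetP (normG _)) ?mem_cycle.
  have Uc a : coset <[s]> (U a) = coset <[s]> u ^+ nat_of_trit a.1.
    by rewrite /U coset_kerr ?mem_cycle // morphX.
  have ow : #[coset <[s]> u] = 3.
    apply: nt_prime_order => //; first by rewrite -morphX //= coset_id ?cube.
    by apply: contra nsu => /eqP; exact: coset_idr.
  have mod_inj l l' : nat_of_trit l = nat_of_trit l' %[mod 3] -> l = l'.
    by case: l; case: l'.
  have Ei : i = i'.
    apply/mod_inj/eqP; rewrite -[X in _ == _ %[mod X]]ow -eq_expg_mod_order.
    by rewrite -(Uc (i, j)) -(Uc (i', j')) E.
  move: E; rewrite /U Ei /= => /mulgI /eqP; rewrite eq_expg_mod_order os.
  by move=> /eqP/mod_inj ->.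
exists k, (fun a => U a e); split=> //.
- by rewrite /U /= !mulg1 expg0 perm1 mul1g expg1 rtrE m1x.
- by move=> a b /(congr1 rtr); rewrite !(BV _ (BU _)).1 => /injU.
- by move=> a; case: (BV _ (BU a)).
move=> x a b; rewrite -!(rtrE bolT) !(BV _ (BU _)).1.
by rewrite -permM UM.
Qed.

End KernelCoordinates.

Lemma odd_sqrg_inj (gT : finGroupType) (G : {group gT}) :
  odd #|G| -> {in G &, injective (fun x => x * x)}.
Proof.
move=> oddG x y Gx Gy /= Exy.
have root z : z \in G -> z = (z * z) ^+ (#|G|.+1./2).
  move=> Gz; rewrite -[z * z]/(z ^+ 2) -expgM mul2n halfK /= oddG /= subn0.
  by rewrite expgS expg_cardG // mulg1.
by rewrite (root x Gx) Exy -root.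
Qed.

(** * Reading the data off the loop *)

Section Coordinates.

Variables (T : finType) (mul : T -> T -> T) (e : T) (gT : finGroupType) (f : T -> gT).
Hypotheses (bolT : bol_loop mul e) (cardT : #|T| = 27).
Local Notation "x * y" := (mul x y) : loop_scope.
Hypotheses (fM : {morph f : x y / (x * y)%L >-> x * y}) (f3 : forall x, f x ^+ 3 = 1).
Variables (k : trit) (U : N9 -> T) (t : T).
Hypotheses (U0 : U o9 = e) (injU : injective U) (fU : forall a, f (U a) = 1).
Hypothesis UM : forall x a b, (x * U a * U b = x * U (add9 k a b))%L.
Hypothesis cnuc : forall x y, (U (Z0, Z1) * (x * y) = U (Z0, Z1) * x * y)%L.
Hypothesis ft : f t <> 1.
Local Open Scope loop_scope.

Let m1x := bol_mul1 bolT.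
Let mx1 := bol_mulr1 bolT.
Let bol := bol_id bolT.
Let s := linv bolT t.
Local Notation rtr := (rtr bolT).

Definition lvl l := match l with Z0 => e | Z1 => t | Z2 => s end.
Definition lab (x : Q27) := lvl x.1 * U x.2.

Let f1 : f e = 1%g.
Proof. exact: ker1 bolT fM. Qed.

Let fs : f s = (f t)^-1%g.
Proof. by apply: (mulgI (f t)); rewrite -fM mulVr f1 mulgV. Qed.

Let f3' : (f t * f t * f t)%g = 1%g.
Proof. by rewrite -(f3 t) expgSr expgS expg1. Qed.

Let f_lvl_inj : injective (f \o lvl).
Proof.
have fs1 : (f t)^-1%g <> 1%g.
  by move=> E; apply: ft; rewrite -[LHS]invgK E invg1.
have fst : (f t)^-1%g <> f t.
  by move=> E; apply: ft; rewrite -[RHS]f3' -[X in (X * _ * _)%g]E mulVg mul1g.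
move=> l l'; rewrite /comp; case: l; case: l' => //=; rewrite ?fs ?f1 => E; exfalso;
  by [exact: ft | exact: fs1 | exact: fst | exact: (nesym ft) | exact: (nesym fs1) | exact: (nesym fst)].
Qed.

Let f_lab x : f (lab x) = f (lvl x.1).
Proof. by rewrite fM fU mulg1. Qed.

Lemma lab_inj : injective lab.
Proof.
move=> [l a] [l' a'] E; have := congr1 f E.
rewrite !f_lab => /f_lvl_inj /= El; move: E; rewrite El.
by move/(bol_injl bolT)/injU => /= ->.
Qed.

Let lab_onto l y : f y = f (lvl l) -> exists a, lab (l, a) = y.
Proof.
have [|[l' a] <-] := inj_onto lab_inj _ y.
  by rewrite !card_prod card_trit cardT.
by rewrite f_lab => /f_lvl_inj /= <-; exists a.
Qed.

Lemma labU x a : lab x * U a = lab (shift k a x).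
Proof. by rewrite /lab UM. Qed.

Let UD a b : U a * U b = U (add9 k a b).
Proof. by rewrite -[U a]m1x UM m1x. Qed.

Let lab0 a : lab (Z0, a) = U a.
Proof. exact: m1x. Qed.

(** [A Z1] and [A Z2] are the permutations al and al'; by [AE] the search always succeeds. *)
Let A l a := odflt o9 [pick b | lab (l, b) == U a * lvl l].

Let AE l a : U a * lvl l = lab (l, A l a).
Proof.
have [b Eb] : exists b, lab (l, b) = U a * lvl l.
  by apply: lab_onto; rewrite fM fU mul1g.
by rewrite /A; case: pickP => [b' /eqP // | /(_ b)]; rewrite Eb eqxx.
Qed.

Let A_inj l : injective (A l).
Proof.
move=> a b E; apply/injU/(bol_injr bolT (a := lvl l)).
by rewrite !AE E.
Qed.

Let A0 l : A l o9 = o9.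
Proof.
have := AE l o9; rewrite U0 m1x -{1}[lvl l]mx1 -U0 -[lvl l * _]/(lab (l, o9)).
by move/lab_inj=> [].
Qed.

Let tripleA l : N9 * N9 * N9 := (A l (Z0, Z1), A l (Z1, Z0), A l (Z2, Z0)).

(** Because [c] is left nuclear, [A l] takes multiplication by [c] to multiplication by its value at
    [c]. *)
Let A_mkal l : A l =1 mkal k (tripleA l).
Proof.
have step a : A l (add9 k a (Z0, Z1)) = add9 k (A l a) (A l (Z0, Z1)).
  suff: lab (l, A l (add9 k a (Z0, Z1))) = lab (l, add9 k (A l a) (A l (Z0, Z1))).
    by case/lab_inj.
  rewrite -AE (add9C k a) -UD -cnuc AE {1}/lab cnuc AE labU.
  by rewrite /shift /= (add9C k (A l a)).
have A1 i : A l (i, Z1) = add9 k (A l (i, Z0)) (A l (Z0, Z1)).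
  by rewrite -step; case: i.
have A2 i : A l (i, Z2) = add9 k (A l (i, Z1)) (A l (Z0, Z1)).
  by rewrite -step; case: i.
have addA a b c : add9 k (add9 k a b) c = add9 k a (add9 k b c).
  by apply: injU; rewrite -[RHS]UD -[LHS]UD -(UD a b) UM.
case=> i []; rewrite /mkal /=.
- by rewrite add90; case: i; rewrite ?A0.
- by rewrite A1; case: i; rewrite ?A0.
by rewrite A2 A1 addA; case: i; rewrite ?A0.
Qed.

Let delta_lab l a : U a * lvl l * U a = lab (l, delta k (A l) a).
Proof. by rewrite AE labU. Qed.

(** If [R_a W R_a = R_b W R_b] for commuting [R_a] and [R_b], then [D W D = W] with
    [D = R_b^-1 R_a]. So [D W] and [W] have equal squares in [rmlt], a group of odd order, whence
    [D] is trivial. *)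
Let delta_inj l : injective (delta k (A l)).
Proof.
move=> a b Eab; apply: injU.
have : rtr (U a * lvl l * U a) = rtr (U b * lvl l * U b) by rewrite !delta_lab Eab.
rewrite -!rtr_bol; move: (rtr (lvl l)) (mem_rmlt bolT (lvl l)) => W GW E.
have cUU : commute (rtr (U a)) (rtr (U b)).
  by apply/permP=> x; rewrite !permM !rtrE !UM add9C.
pose D := ((rtr (U b))^-1 * rtr (U a))%g.
have GD : D \in rmlt bolT by rewrite groupM ?groupV ?mem_rmlt.
have DWD : (D * W * D = W)%g.
  have {2}-> : D = (rtr (U a) * (rtr (U b))^-1)%g.
    by rewrite /D; apply: (mulgI (rtr (U b))); rewrite mulKVg mulgA -cUU mulgK.
  rewrite !mulgA -3!(mulgA (rtr (U b))^-1) E.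
  by rewrite !mulgA mulVg mul1g mulgK.
have oG : odd #|rmlt bolT|.
  have pG : 3.-group (rmlt bolT) := @rmlt_pgroup T mul e 3 3 bolT isT isT cardT.
  by rewrite (card_pgroup pG) oddX orbT.
have : (D * W)%g = W.
  apply: (odd_sqrg_inj oG) => /=; [exact: groupM | by [] |].
  by rewrite [LHS]mulgA DWD.
rewrite -{2}(mul1g W) => /mulIg /(congr1 (mulg (rtr (U b)))).
by rewrite /D mulKVg mulg1 => /rtr_inj.
Qed.

Let delta_onto l b : exists a, delta k (A l) a = b.
Proof. exact: inj_onto (@delta_inj l) erefl b. Qed.

Let lab_delta l b : exists2 a, delta k (A l) a = b &
  forall x, x * lab (l, b) = x * U a * lvl l * U a.
Proof.
have [a Ea] := delta_onto l b; exists a => // x.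
by rewrite bol delta_lab Ea.
Qed.

Let conj_lab l y : f y = f (lvl l) -> exists a, forall x, x * y = x * U a * lvl l * U a.
Proof. by move/lab_onto=> [b <-]; have [a _ Ea] := lab_delta l b; exists a. Qed.

Let onto9_inj g : injective g -> onto9 g.
Proof.
move=> inj_g; apply/all9P=> y; apply/eq9P.
by have [x <-] := inj_onto inj_g erefl y; rewrite inv9K.
Qed.

Let eq_onto9 (g h : N9 -> N9) : g =1 h -> onto9 g -> onto9 h.
Proof.
move=> E /all9P g_onto; apply/all9P=> y; have /eq9P := g_onto y.
by rewrite E (eq_inv9 E) => ?; apply/eq9P.
Qed.

Let memoA l : memo9 (mkal k (tripleA l)) =1 A l.
Proof. by move=> a; rewrite memo9E A_mkal. Qed.

Let invA l a : inv9 (memo9 (mkal k (tripleA l))) (A l a) = a.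
Proof.
apply: (A_inj (l := l)); have := inv9K (memo9 (mkal k (tripleA l))) a.
by rewrite !memoA.
Qed.

Lemma tripleA_ok l : tripleA l \in als k.
Proof.
rewrite mem_filter; apply/andP; split; last first.
  by rewrite /tripleA; do 2 (apply: allpairs_f; rewrite ?mem_seq9 //).
rewrite /al_ok (eq_onto9 (fsym (@memoA l))); last exact/onto9_inj/A_inj.
have E : delta k (A l) =1 delta k (memo9 (mkal k (tripleA l))).
  by move=> a; rewrite /delta memoA.
rewrite (eq_onto9 E); last exact/onto9_inj/delta_inj.
apply/all9P=> m.
(* Two uses of the Bol identity make the left side a right translation, by an element over
   [f (lvl l)]. *)
have [n En] : exists n, forall x,
    x * lvl l * U m * linv bolT (lvl l) * U m * lvl l = x * U n * lvl l * U n.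
  have [|n En] := @conj_lab l (lvl l * (U m * linv bolT (lvl l) * U m) * lvl l).
    by rewrite !fM fU mulg1 mul1g -fM mulVr f1 mul1g.
  by exists n => x; rewrite -En -[RHS]bol bol.
set q := (X in pick9 X); have [|b -> //] := @pick9_some q n.
apply/all9P=> x; apply/eq9P; rewrite !memoA memo9E.
have := En (U x); rewrite AE labU UD AE labU /shift /=.
have [y Ey] := inj_onto (@A_inj l) erefl (add9 k (A l x) m).
rewrite -Ey invA -AE mulKr UD AE.
by case/lab_inj.
Qed.

Let ralt x y : x * y * y = x * (y * y).
Proof. by have := bol x y e; rewrite !mx1. Qed.

Lemma bol27_coordinates : exists2 d, d \in datas k &
  forall x y, lab (bmul k d x y) = lab x * lab y.
Proof.
have fts : f (t * t) = f s.
  by rewrite fs; apply: (mulIg (f t)); rewrite fM f3' mulVg.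
(* [t * t] lies in the coset of [t^-1], so its right translation is [R_n R_t^-1 R_n]; this [n] is
   the last datum. *)
have [n tt] := @conj_lab Z2 (t * t) fts.
pose d : data := (tripleA Z1, tripleA Z2, n).
have A_onto l := inj_onto (@A_inj l) erefl.
have labT x : lab (mkT k d x) = lab x * t.
  rewrite /mkT /d memo27E; case: x => -[] a /=.
  - by rewrite memoA -(AE Z1) lab0.
  - have [b <-] := A_onto Z1 a; rewrite !memoA memo9E invA.
    by rewrite -(AE Z1) ralt tt UD (AE Z2) labU.
  have [b <-] := A_onto Z2 a; rewrite memo9E invA -(AE Z2) mulVKr.
  exact: lab0.
have dA l : delta k (mkal k (tripleA l)) =1 delta k (A l).
  by move=> a; rewrite /delta A_mkal.
have inv_delta l b : delta k (A l) (inv9 (delta k (mkal k (tripleA l))) b) = b.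
  have [a <-] := delta_onto l b; rewrite -!dA inv9K //.
exists d.
  rewrite mem_filter allpairs_f ?mem_seq9 ?allpairs_f ?tripleA_ok // andbT.
  apply/all9P=> m.
  have [|j Ej] := @conj_lab Z2 (t * U m * t); first by rewrite !fM fU mulg1 -fM.
  set q := (X in pick9 X); have [|b -> //] := @pick9_some q j.
  apply/all27P=> x; apply/eq27P/lab_inj.
  (* By the Bol identity [R_t R_m R_t] is [R_j R_t^-1 R_j]; then [U (opp9 k j)] and [t] cancel its
     last two factors. *)
  rewrite -[RHS]labU labT -labU labT -labU labT [_ * _ * U m * t]bol Ej.
  by rewrite UM add9N U0 mx1 mulVKr.
have lab_conj l x m b : delta k (A l) m = b ->
    lab x * lab (l, b) = lab x * U m * lvl l * U m.
  by move=> <-; rewrite bol delta_lab.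
move=> x y; rewrite /bmul memo27E memo27E; case: y => -[] b /=.
- by rewrite -labU lab0.
- by rewrite memo9E (lab_conj _ _ _ _ (inv_delta _ b)) -labU labT labU.
rewrite memo9E (lab_conj _ _ _ _ (inv_delta _ b)) -labU; congr (_ * _).
rewrite memo27E labU; set w := shift _ _ _.
set q := (X in pick27 X); have [v Ev] : exists v, mkT k d v = w.
  apply: inj_onto => // v v' E; apply/lab_inj/(bol_injr bolT (a := t)).
  by rewrite /= -!labT E.
have [|v' -> /eq27P Ev'] := @pick27_some q v; first by apply/eq27P.
by rewrite -Ev' labT mulKr.
Qed.

End Coordinates.

Lemma bol27_data (T : finType) (mul : T -> T -> T) (e : T) :
    bol_loop mul e -> #|T| = 27 ->
  exists k d (lab : Q27 -> T),
    [/\ k = Z0 \/ k = Z1, d \in datas k, injective lab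
      & forall x y, lab (bmul k d x y) = mul (lab x) (lab y)].
Proof.
move=> bolT cardT.
have [gT [f [c [[fM f3 cker] [c_neq1 fc nuc]]]]] :=
  @bol_p_structure T mul e 3 3 bolT isT isT cardT isT.
rewrite /= (bol_mulr1 bolT) => ccc.
have {}cker : #|[set x | f x == 1]| = 9.
  by apply/eqP; rewrite -(@eqn_pmul2r 3) // cker cardT.
have [k [U [kE [U0 U1] injU fU UM]]] := kernel_coordinates bolT fM cker fc c_neq1 ccc.
have [t ft] : exists t, f t <> 1.
  case: (pickP (fun t => f t != 1)) => [t /eqP ft|fT]; first by exists t.
  move: cker; rewrite (eq_card (B := T)) ?cardT // => x.
  by rewrite !inE; apply: negbFE (fT x).
rewrite -U1 in nuc.
have [d dk labM] := bol27_coordinates bolT cardT fM f3 U0 injU fU UM nuc ft.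
exists k, d, (lab bolT U t); split=> //.
exact: (lab_inj fM f3 injU fU ft).
Qed.

End Translations.

(** * The fifteen loops *)

Definition seq27 : seq Q27 := [seq (l, a) | l <- seq3, a <- seq9].

(** Numbers are positions in [seq9], where [u^i c^j] has position [3 i + j]: 1 is [c], 3 is [u] and
    6 is [u^2]. *)
Definition rep (k : trit) (a b : nat * nat * nat) (n : nat) : trit * data :=
  let el i := nth o9 seq9 i in
  (k, ((el a.1.1, el a.1.2, el a.2), (el b.1.1, el b.1.2, el b.2), el n)).

Definition reps : seq (trit * data) :=
  [:: rep Z0 (1, 3, 6) (1, 3, 6) 0;
   rep Z0 (1, 3, 6) (1, 3, 6) 1;
   rep Z0 (1, 3, 6) (1, 4, 8) 0;
   rep Z0 (1, 3, 7) (1, 3, 8) 1;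
   rep Z0 (1, 3, 7) (1, 3, 8) 2;
   rep Z0 (1, 3, 7) (1, 5, 6) 0;
   rep Z0 (1, 3, 7) (1, 5, 6) 1;
   rep Z0 (1, 3, 7) (1, 5, 6) 2;
   rep Z0 (1, 4, 8) (1, 5, 7) 0;
   rep Z0 (1, 4, 8) (1, 5, 7) 1;
   rep Z0 (3, 2, 1) (4, 5, 7) 0;
   rep Z0 (3, 4, 8) (7, 2, 1) 0;
   rep Z1 (1, 3, 6) (1, 3, 6) 3;
   rep Z1 (1, 3, 6) (1, 4, 8) 1;
   rep Z1 (1, 3, 7) (1, 5, 6) 1].

Definition rep_mul (i : nat) : Q27 -> Q27 -> Q27 :=
  let r := nth (Z0, (o9, o9, o9, (o9, o9, o9), o9)) reps i in bmul r.1 r.2.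

Definition tables : seq (Q27 -> Q27 -> Q27) := [seq bmul r.1 r.2 | r <- reps].

Definition div27 (m : Q27 -> Q27 -> Q27) (x z : Q27) : Q27 :=
  odflt o27 (pick27 (fun y => eq27 (m x y) z)).

(** The only candidate for a homomorphism into [m] with the given images of the generators; [iso_ok]
    tests it. *)
Definition gen_map (m : Q27 -> Q27 -> Q27) (t u c : Q27) : Q27 -> Q27 :=
  let t' := div27 m t o27 in
  let pw v (i : trit) := match i with Z0 => o27 | Z1 => v | Z2 => m v v end in
  memo27 (fun x =>
    m (match x.1 with Z0 => o27 | Z1 => t | Z2 => t' end) (m (pw u x.2.1) (pw c x.2.2))).

Definition onto27 (g : Q27 -> Q27) : bool :=
  all27 (fun y => isSome (pick27 (fun x => eq27 (g x) y))).

Definition iso_ok (m1 m2 : Q27 -> Q27 -> Q27) (t u c : Q27) : bool :=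
  let g := gen_map m2 t u c in
  if onto27 g then all27 (fun x => all27 (fun y => eq27 (g (m1 x y)) (m2 (g x) (g y))))
  else false.

Definition leaf_ok (ts : seq (Q27 -> Q27 -> Q27)) (k : trit) (d : data)
    (w : nat * (nat * nat * nat)) : bool :=
  let: (i, (t, u, c)) := w in
  let el j := nth o27 seq27 j in
  if i < 15 then iso_ok (bmul k d) (nth (fun x _ => x) ts i) (el t) (el u) (el c) else false.

(* (i, (t, u, c)): the generators of the loop are sent to the elements numbered
   t, u, c of [rep_mul i]. *)
Definition witnesses0 : seq (nat * (nat * nat * nat)) :=
  [:: (0, (9, 3, 1)); (1, (9, 3, 1)); (1, (18, 3, 1)); (1, (9, 1, 3)); (1, (9, 7, 3));
   (1, (9, 4, 3)); (1, (18, 1, 3)); (1, (18, 4, 3)); (1, (18, 7, 3)); (2, (9, 3, 1));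
   (2, (12, 3, 1)); (2, (15, 3, 1)); (2, (9, 6, 1)); (2, (12, 6, 1)); (2, (15, 6, 1));
   (2, (9, 4, 3)); (2, (12, 4, 3)); (2, (15, 4, 3)); (2, (9, 1, 3)); (2, (12, 1, 3));
   (2, (15, 1, 3)); (2, (9, 7, 3)); (2, (12, 7, 3)); (2, (15, 7, 3)); (2, (9, 8, 3));
   (2, (15, 8, 3)); (2, (12, 8, 3)); (2, (9, 2, 3)); (2, (15, 2, 3)); (2, (12, 2, 3));
   (2, (9, 5, 3)); (2, (15, 5, 3)); (2, (12, 5, 3)); (2, (6, 9, 1)); (3, (9, 3, 1));
   (4, (9, 3, 1)); (3, (15, 6, 1)); (4, (15, 6, 1)); (2, (24, 18, 1)); (5, (9, 3, 1));
   (6, (9, 3, 1)); (7, (9, 3, 1)); (2, (3, 9, 1)); (4, (18, 3, 1)); (3, (18, 3, 1));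
   (5, (21, 3, 1)); (7, (21, 3, 1)); (6, (21, 3, 1)); (3, (24, 6, 1)); (2, (21, 18, 1));
   (4, (24, 6, 1)); (5, (15, 3, 1)); (6, (15, 3, 1)); (7, (15, 3, 1)); (3, (15, 3, 1));
   (4, (15, 3, 1)); (2, (24, 9, 1)); (2, (6, 18, 1)); (3, (9, 6, 1)); (4, (9, 6, 1));
   (3, (21, 6, 1)); (2, (12, 18, 1)); (4, (21, 6, 1)); (3, (21, 3, 1)); (2, (12, 9, 1));
   (4, (21, 3, 1)); (7, (24, 3, 1)); (6, (24, 3, 1)); (5, (24, 3, 1)); (2, (18, 3, 1));
   (2, (21, 3, 1)); (2, (24, 3, 1)); (7, (3, 12, 1)); (7, (18, 12, 1)); (7, (9, 12, 1));
   (8, (9, 3, 1)); (9, (9, 3, 1)); (9, (18, 6, 1)); (5, (18, 3, 1)); (7, (18, 3, 1));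
   (6, (18, 3, 1)); (2, (3, 18, 1)); (4, (18, 6, 1)); (3, (18, 6, 1)); (3, (24, 3, 1));
   (2, (21, 9, 1)); (4, (24, 3, 1)); (2, (18, 6, 1)); (2, (21, 6, 1)); (2, (24, 6, 1));
   (8, (18, 3, 1)); (9, (9, 6, 1)); (9, (18, 3, 1)); (7, (3, 24, 1)); (7, (18, 24, 1));
   (7, (9, 24, 1)); (3, (12, 6, 1)); (4, (12, 6, 1)); (2, (15, 18, 1)); (7, (12, 3, 1));
   (5, (12, 3, 1)); (6, (12, 3, 1)); (3, (12, 3, 1)); (4, (12, 3, 1)); (2, (15, 9, 1));
   (10, (9, 3, 1)); (11, (9, 3, 1)); (10, (18, 4, 1)); (2, (18, 4, 3)); (2, (21, 4, 3));
   (2, (24, 4, 3)); (7, (3, 13, 12)); (7, (18, 13, 12)); (7, (9, 13, 12));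
   (8, (9, 4, 3)); (9, (9, 4, 3)); (9, (18, 7, 6)); (11, (9, 5, 1)); (2, (18, 1, 3));
   (2, (21, 1, 3)); (2, (24, 1, 3)); (7, (3, 1, 12)); (7, (18, 1, 12)); (7, (9, 1, 12));
   (8, (9, 1, 3)); (9, (9, 1, 3)); (9, (18, 1, 6)); (10, (18, 3, 1)); (10, (9, 5, 1));
   (10, (18, 5, 1)); (2, (18, 7, 3)); (2, (21, 7, 3)); (2, (24, 7, 3)); (7, (3, 25, 12));
   (7, (18, 25, 12)); (7, (9, 25, 12)); (8, (9, 7, 3)); (9, (9, 7, 3)); (9, (18, 4, 6));
   (10, (9, 4, 1)); (11, (9, 4, 1)); (10, (9, 6, 1)); (11, (18, 5, 1)); (2, (18, 8, 3));
   (2, (24, 8, 3)); (2, (21, 8, 3)); (8, (18, 7, 3)); (9, (9, 4, 6)); (9, (18, 7, 3));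
   (7, (3, 26, 12)); (7, (9, 26, 12)); (7, (18, 26, 12)); (10, (18, 8, 1));
   (11, (18, 3, 1)); (2, (18, 2, 3)); (2, (24, 2, 3)); (2, (21, 2, 3)); (8, (18, 1, 3));
   (9, (9, 1, 6)); (9, (18, 1, 3)); (7, (3, 2, 12)); (7, (9, 2, 12)); (7, (18, 2, 12));
   (10, (18, 6, 1)); (10, (9, 7, 1)); (2, (18, 5, 3)); (2, (24, 5, 3)); (2, (21, 5, 3));
   (8, (18, 4, 3)); (9, (9, 7, 6)); (9, (18, 4, 3)); (7, (3, 14, 12)); (7, (9, 14, 12));
   (7, (18, 14, 12)); (10, (18, 7, 1)); (10, (9, 8, 1)); (11, (18, 4, 1))].

Definition witnesses1 : seq (nat * (nat * nat * nat)) :=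
  [:: (1, (3, 18, 1)); (1, (12, 18, 1)); (1, (21, 18, 1)); (12, (9, 3, 1));
   (12, (15, 3, 1)); (12, (12, 3, 1)); (12, (24, 3, 1)); (12, (21, 3, 1));
   (12, (18, 3, 1)); (3, (3, 18, 1)); (13, (9, 3, 1)); (13, (9, 6, 2)); (4, (3, 9, 1));
   (4, (12, 9, 1)); (4, (21, 9, 1)); (2, (6, 15, 1)); (13, (3, 9, 2)); (4, (9, 21, 1));
   (4, (6, 24, 1)); (2, (21, 24, 1)); (13, (24, 18, 1)); (7, (3, 9, 1)); (14, (9, 3, 1));
   (6, (21, 18, 1)); (2, (3, 15, 1)); (4, (18, 21, 1)); (13, (6, 9, 2)); (6, (6, 18, 1));
   (14, (21, 3, 1)); (7, (15, 9, 1)); (2, (18, 24, 1)); (4, (15, 24, 1));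
   (13, (21, 18, 1)); (6, (3, 18, 1)); (7, (21, 9, 1)); (14, (15, 3, 1));
   (2, (18, 15, 1)); (13, (21, 9, 2)); (4, (24, 21, 1)); (2, (6, 24, 1));
   (13, (6, 18, 1)); (4, (9, 24, 1)); (4, (3, 24, 1)); (13, (12, 18, 1));
   (2, (15, 24, 1)); (2, (9, 15, 1)); (4, (12, 21, 1)); (13, (15, 9, 2));
   (7, (24, 9, 1)); (6, (24, 18, 1)); (14, (24, 3, 1)); (3, (6, 18, 1));
   (13, (18, 6, 2)); (13, (18, 3, 1)); (6, (3, 12, 1)); (6, (9, 12, 1));
   (6, (18, 12, 1)); (9, (3, 18, 1)); (9, (12, 18, 1)); (9, (21, 18, 1)); (7, (6, 9, 1));
   (6, (15, 18, 1)); (14, (18, 3, 1)); (2, (3, 24, 1)); (4, (18, 24, 1));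
   (13, (3, 18, 1)); (4, (6, 21, 1)); (13, (24, 9, 2)); (2, (24, 15, 1)); (4, (6, 9, 1));
   (4, (15, 9, 1)); (4, (24, 9, 1)); (9, (6, 18, 1)); (9, (15, 18, 1)); (9, (24, 18, 1));
   (5, (3, 24, 1)); (14, (6, 24, 1)); (14, (3, 24, 1)); (2, (9, 24, 1));
   (13, (15, 18, 1)); (4, (21, 24, 1)); (7, (12, 9, 1)); (14, (12, 3, 1));
   (6, (12, 18, 1)); (4, (3, 21, 1)); (2, (12, 15, 1)); (13, (12, 9, 2))].

(** * Matching every datum with a representative *)

Lemma leaves0 : all2 (leaf_ok tables Z0) (datas Z0) witnesses0.
Proof. by vm_compute. Qed.

Lemma leaves1 : all2 (leaf_ok tables Z1) (datas Z1) witnesses1.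
Proof. by vm_compute. Qed.

Lemma onto27_bij (g : Q27 -> Q27) : onto27 g -> bijective g.
Proof.
move=> /all27P og.
pose h y := odflt o27 (pick27 (fun x => eq27 (g x) y)).
have hK : cancel h g.
  move=> y; have := og y; rewrite /h; case E: (pick27 _) => [x|] // _.
  exact/eq27P/(pick27_mem E).
have bij_h : bijective h by apply: injF_bij; exact: can_inj hK.
exact: bij_can_bij bij_h g hK.
Qed.

Lemma iso_ok_iso m1 m2 t u c : iso_ok m1 m2 t u c -> loop_iso m1 m2.
Proof.
rewrite /iso_ok; case: ifP => // /onto27_bij bij_g /all27P gM.
exists (gen_map m2 t u c); split=> // x y; apply/eq27P.
by have /all27P := gM x.
Qed.

Lemma all2_mem (A : eqType) (B : Type) (r : A -> B -> bool) (s : seq A) (w : seq B) x :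
  all2 r s w -> x \in s -> exists y, r x y.
Proof.
elim: s w => [|a s IHs] [|b w] //= /andP[rab rsw]; rewrite inE => /orP[/eqP -> | ].
  by exists b.
exact: IHs rsw.
Qed.

Lemma nth_tables i : i < 15 -> nth (fun x _ => x) tables i = rep_mul i.
Proof. by move=> lti; rewrite (nth_map (Z0, (o9, o9, o9, (o9, o9, o9), o9))). Qed.

Lemma datas_iso k d : k = Z0 \/ k = Z1 -> d \in datas k ->
  exists i : 'I_15, loop_iso (bmul k d) (rep_mul i).
Proof.
move=> kE dk.
have [[i [[t u] c]]] : exists w, leaf_ok tables k d w.
  case: kE dk => -> dk; first exact (all2_mem leaves0 dk).
  exact (all2_mem leaves1 dk).
rewrite /leaf_ok; case: ifP => // lti; rewrite nth_tables // => /iso_ok_iso iso.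
by exists (Ordinal lti).
Qed.

(** * Bol identity and associativity of the representatives *)

Definition rep_ok (m : Q27 -> Q27 -> Q27) : bool :=
  [&& all27 (fun x => eq27 (m o27 x) x), all27 (fun x => eq27 (m x o27) x),
      all27 (fun x => onto27 (m x)), all27 (fun y => onto27 (m^~ y))
    & all27 (fun y => all27 (fun z => let w := m (m y z) y in
        all27 (fun x => eq27 (m (m (m x y) z) y) (m x w))))].

Lemma tables_ok : all rep_ok tables.
Proof. by vm_compute. Qed.

Lemma rep_mul_bol (i : 'I_15) : is_loop (rep_mul i) /\ right_bol (rep_mul i).
Proof.
have /and5P[/all27P m1x /all27P mx1 /all27P ol /all27P or /all27P bol] : rep_ok (rep_mul i).
  rewrite -nth_tables //; have /(all_nthP (fun x _ => x)) H := tables_ok.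
  by apply: H; rewrite size_map.
split.
  split; first by exists o27 => x; split; apply/eq27P.
  by split=> a; apply: onto27_bij.
by move=> x y z; have /all27P/(_ z)/all27P/(_ x)/eq27P := bol y.
Qed.

Definition assocb (m : Q27 -> Q27 -> Q27) : bool :=
  all27 (fun x => all27 (fun y => let w := m x y in
    all27 (fun z => eq27 (m x (m y z)) (m w z)))).

Lemma assocbP m : reflect (associative m) (assocb m).
Proof.
apply: (iffP (all27P _)) => [H x y z | H x].
  by have /all27P/(_ y)/all27P/(_ z)/eq27P := H x.
by apply/all27P=> y; apply/all27P=> z; apply/eq27P.
Qed.

(** In this order: the elementary abelian group, the product of cyclic groups of orders 9 and 3, the
    nonabelian groups of exponents 3 and 9, and the cyclic group. *)
Lemma tables_assoc : [seq assocb m | m <- tables] =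
  [seq i \in [:: 0; 1; 8; 9; 12] | i <- iota 0 15].
Proof. by vm_compute. Qed.

Lemma rep_mul_assoc (i : 'I_15) :
  val i \in [:: 0; 1; 8; 9; 12] <-> associative (rep_mul i).
Proof.
suff <- : assocb (rep_mul i) = (val i \in [:: 0; 1; 8; 9; 12]) by split=> /assocbP.
have lti : i < size tables by rewrite size_map.
have lti' : i < size (iota 0 15) by rewrite size_iota.
rewrite -nth_tables // -(nth_map (fun x _ => x) false assocb lti) tables_assoc.
by rewrite (nth_map 0 false _ lti') nth_iota.
Qed.

(** * Invariants that separate the representatives *)

Definition pairs27 : seq (Q27 * Q27) := [seq (x, y) | x <- seq27, y <- seq27].

Lemma uniq_seq27 : uniq seq27.
Proof. by vm_compute. Qed.

Lemma mem_seq27 x : x \in seq27.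
Proof. by case: x => l a; apply: allpairs_f; [case: l | exact: mem_seq9]. Qed.

Lemma count_pairs27 (f : Q27 -> Q27) (p q : Q27 * Q27 -> bool) : bijective f ->
  (forall x y, p (x, y) = q (f x, f y)) -> count p pairs27 = count q pairs27.
Proof.
case=> g fK gK pq; pose h z := (f z.1, f z.2).
have injh : injective h by case=> x y [x' y'] [/(can_inj fK) -> /(can_inj fK) ->].
have [uP mP] : uniq pairs27 /\ forall z, z \in pairs27.
  split; first by apply: allpairs_uniq uniq_seq27 uniq_seq27 _ => -[x y] [x' y'].
  by case=> x y; apply: allpairs_f; exact: mem_seq27.
move: pairs27 uP mP => P uP mP.
rewrite (@eq_count _ p (preim h q)); last by case=> x y; exact: pq.
rewrite -count_map; apply: (seq.permP _ q); apply: uniq_perm => //.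
  by rewrite map_inj_uniq.
move=> [x y]; rewrite mP; apply/mapP; exists (g x, g y) => //.
by rewrite /h !gK.
Qed.

(** In a loop the first count is 27 times the number of elements with trivial cube; this form avoids
    naming the identity. The three counts together distinguish all fifteen tables. *)
Definition inv27 (m : Q27 -> Q27 -> Q27) : nat * nat * nat :=
  (count (fun z => eq27 (m (m (m z.1 z.1) z.1) z.2) z.2) pairs27,
   count (fun z => eq27 (m z.1 z.2) (m z.2 z.1)) pairs27,
   count (fun z => eq27 (m z.1 (m z.2 z.1)) (m z.2 z.2)) pairs27).

Lemma inv27_iso m1 m2 : loop_iso m1 m2 -> inv27 m1 = inv27 m2.
Proof.
case=> f [bij_f fM].
have eqf x y : eq27 x y = eq27 (f x) (f y).
  by apply/eq27P/eq27P => [-> | /(bij_inj bij_f)].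
by congr (_, _, _); apply: (count_pairs27 bij_f) => x y /=; rewrite eqf !fM.
Qed.

Lemma tables_inv : uniq [seq inv27 m | m <- tables].
Proof. by vm_compute. Qed.

Lemma rep_mul_inj (i j : 'I_15) : loop_iso (rep_mul i) (rep_mul j) -> i = j.
Proof.
move/inv27_iso; rewrite -!nth_tables // => E.
apply/val_inj/eqP; have := nth_uniq (inv27 (fun x _ => x)) _ _ tables_inv.
have lt15 (l : 'I_15) : l < size tables by rewrite size_map.
have lt15' (l : 'I_15) : l < size [seq inv27 m | m <- tables] by rewrite !size_map.
move=> /(_ i j (lt15' i) (lt15' j)) <-; apply/eqP.
by rewrite !(nth_map (fun x _ => x) _ inv27 (lt15 _)) E.
Qed.

(** * Transport along isomorphisms and final assembly *)

Lemma loop_iso_sym (A B : Type) (m1 : A -> A -> A) (m2 : B -> B -> B) :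
  loop_iso m1 m2 -> loop_iso m2 m1.
Proof.
case=> f [[g fK gK] fM]; exists g; split; first by exists f.
by move=> x y; apply: (can_inj fK); rewrite fM !gK.
Qed.

Lemma loop_iso_trans (A B C : Type) (m1 : A -> A -> A) (m2 : B -> B -> B) (m3 : C -> C -> C) :
  loop_iso m1 m2 -> loop_iso m2 m3 -> loop_iso m1 m3.
Proof.
case=> f [bij_f fM] [g [bij_g gM]]; exists (g \o f); split; first exact: bij_comp.
by move=> x y /=; rewrite fM gM.
Qed.

Lemma iso_is_loop (A B : Type) (m1 : A -> A -> A) (m2 : B -> B -> B) :
  loop_iso m1 m2 -> is_loop m1 -> is_loop m2.
Proof.
case=> f [[g fK gK] fM] [[u uP] [bl br]].
have bf : bijective f by exists g.
have bg : bijective g by exists f.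
split; [|split] => [|a|a].
- exists (f u) => x; rewrite -[x]gK -!fM.
  by have [-> ->] := uP (g x).
- apply: (eq_bij (bij_comp bf (bij_comp (bl (g a)) bg))) => x /=.
  by rewrite fM !gK.
apply: (eq_bij (bij_comp bf (bij_comp (br (g a)) bg))) => x /=.
by rewrite fM !gK.
Qed.

Lemma iso_right_bol (A B : Type) (m1 : A -> A -> A) (m2 : B -> B -> B) :
  loop_iso m1 m2 -> right_bol m1 -> right_bol m2.
Proof.
case=> f [[g fK gK] fM] bol x y z.
by rewrite -[x]gK -[y]gK -[z]gK -!fM bol.
Qed.

Lemma iso_group_loop (A B : Type) (m1 : A -> A -> A) (m2 : B -> B -> B) :
  loop_iso m1 m2 -> is_group_loop m1 -> is_group_loop m2.
Proof.
case=> f [[g fK gK] fM] assoc x y z.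
by rewrite -[x]gK -[y]gK -[z]gK -!fM assoc.
Qed.

Theorem theorem5p2 :
  exists L : 'I_15 -> 'I_27 -> 'I_27 -> 'I_27,
    (forall i, is_loop (L i) /\ right_bol (L i)) /\
    (forall i j, loop_iso (L i) (L j) -> i = j) /\
    (forall (T : finType) (m : T -> T -> T),
        #|T| = 27 -> is_loop m -> right_bol m ->
        exists i, loop_iso m (L i)) /\
    (exists S : {set 'I_15}, #|S| = 5 /\
        forall i, i \in S <-> is_group_loop (L i)).
Proof.
have cardQ : #|{: Q27}| = 27 by rewrite !card_prod card_trit.
(* The representatives live on [Q27]; [enc] and [dec] carry them to ['I_27]. *)
pose enc (x : Q27) := cast_ord cardQ (enum_rank x).
pose dec (a : 'I_27) : Q27 := enum_val (cast_ord (esym cardQ) a).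
have encK : cancel enc dec by move=> x; rewrite /enc /dec cast_ordK enum_rankK.
have decK : cancel dec enc by move=> a; rewrite /enc /dec enum_valK cast_ordKV.
pose L (i : 'I_15) a b := enc (rep_mul i (dec a) (dec b)).
have isoL (i : 'I_15) : loop_iso (rep_mul i) (L i).
  by exists enc; split=> [|x y]; [exists dec | rewrite /L !encK].
exists L; split=> [i|]; last split=> [i j ij|]; last split=> [T m cardT loop_m bol_m|].
- have [loop_i bol_i] := rep_mul_bol i.
  by split; [apply: iso_is_loop loop_i | apply: iso_right_bol bol_i].
- apply: rep_mul_inj; apply: loop_iso_trans (isoL i) _.
  exact: loop_iso_trans ij (loop_iso_sym (isoL j)).
- have [[u uP] [bl br]] := loop_m.
  have bolT : bol_loop m u.
    by split=> // [x|x|a|a]; [case: (uP x) | case: (uP x) | exact: bij_inj | exact: bij_inj].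
  have [k [d [lb [kE dk inj_lb lbM]]]] := bol27_data bolT cardT.
  have [i iso_i] := datas_iso kE dk.
  exists i; apply: loop_iso_trans (isoL i); apply: loop_iso_trans iso_i.
  apply: loop_iso_sym; exists lb; split=> //.
  by apply: inj_card_bij; rewrite // cardT cardQ.
exists [set i : 'I_15 | val i \in [:: 0; 1; 8; 9; 12]]; split.
  rewrite cardsE -sum1_card big_mkcond /=.
  by rewrite !big_ord_recl big_ord0.
move=> i; rewrite inE; apply: (iff_trans (rep_mul_assoc i)).
by split; apply: iso_group_loop; [|apply: loop_iso_sym].
Qed.
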